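(* As $\epsilon$ ranges over $(0,\infty)$, the number of transitions of the signature $s(M(\epsilon))=N_+(M(\epsilon))-N_-(M(\epsilon))$ is at most $$n-\dim(\ker(A_\mathcal{H})).$$
   Context: Let $\mathcal{F}=\{\mathcal{V},\mathcal{E}\}$ be a simple undirected graph with $\mathcal{V}=\{1,\dots,n\}$. Let $\mathcal{G}=\{\mathcal{V},\mathcal{E}_\mathcal{G}\}$ and $\mathcal{H}=\{\mathcal{V},\mathcal{E}_\mathcal{H}\}$ be subgraphs of $\mathcal{F}$ on the same vertex set with $\mathcal{E}_\mathcal{G}\cap\mathcal{E}_\mathcal{H}=\emptyset$ and $\mathcal{E}_\mathcal{G}\cup\mathcal{E}_\mathcal{H}=\mathcal{E}$. For a real parameter $\epsilon>0$ define the symmetric $n\times n$ matrix $M(\epsilon)=L_\mathcal{G}+\epsilon A_\mathcal{H}$, where $L_\mathcal{G}$ is the Laplacian matrix of $\mathcal{G}$ (degree matrix minus adjacency matrix) and $A_\mathcal{H}$ is the $0/1$ adjacency matrix of $\mathcal{H}$. For a real symmetric matrix $Q$, $N_+(Q)$ and $N_-(Q)$ are the numbers of positive and negative eigenvalues of $Q$, counted with multiplicity. A transition of the signature is a value $\epsilon_*>0$ at which the function $\epsilon\mapsto s(M(\epsilon))$ changes, i.e. is not locally constant; the number of transitions is the number of such values $\epsilon_*$. *)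

(* Defs.v *)
From HB Require Import structures.
From mathcomp Require Import all_boot all_order all_algebra.
From mathcomp Require Import polyrcf.
From mathcomp Require Import all_classical all_reals topology normedtype.

Set Implicit Arguments.
Unset Strict Implicit.
Unset Printing Implicit Defensive.

Import Order.TTheory GRing.Theory Num.Theory.
Import numFieldNormedType.Exports.

Local Open Scope classical_set_scope.
Local Open Scope ring_scope.

(* Simple undirected graphs on the vertex set 'I_n: the edges are two-element
   sets of vertices, so there are no loops and no multiple edges. *)
Record sgraph (n : nat) := SGraph {
  edges : {set {set 'I_n}};
  edges_card2 : forall e, e \in edges -> #|e| = 2%N
}.

Definition adjacent n (G : sgraph n) (i j : 'I_n) : bool :=
  [set i; j]%SET \in edges G.

Definition degree n (G : sgraph n) (i : 'I_n) : nat :=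
  #|[set j | adjacent G i j]%SET|.

Definition adjacency_mx (R : realType) n (G : sgraph n) : 'M[R]_n :=
  \matrix_(i, j) (adjacent G i j)%:R.

Definition degree_mx (R : realType) n (G : sgraph n) : 'M[R]_n :=
  diag_mx (\row_i (degree G i)%:R).

Definition laplacian_mx (R : realType) n (G : sgraph n) : 'M[R]_n :=
  degree_mx R G - adjacency_mx R G.

Definition Mmx (R : realType) n (G H : sgraph n) (eps : R) : 'M[R]_n :=
  laplacian_mx R G + eps *: adjacency_mx R H.

(* [rootsR] lists each real root once; [mup] is its multiplicity. A symmetric
   real matrix has only real eigenvalues, each with algebraic multiplicity
   equal to its geometric multiplicity. *)
Definition Npos (R : realType) n (Q : 'M[R]_n) : nat :=
  (\sum_(x <- rootsR (char_poly Q) | (0 < x)%R) mup x (char_poly Q))%N.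

Definition Nneg (R : realType) n (Q : 'M[R]_n) : nat :=
  (\sum_(x <- rootsR (char_poly Q) | (x < 0)%R) mup x (char_poly Q))%N.

Definition signature (R : realType) n (Q : 'M[R]_n) : int :=
  (Npos Q)%:Z - (Nneg Q)%:Z.

(* [Mmx G H] is defined on the whole of R, but a neighbourhood of a point
   eps > 0 in R can always be shrunk into the positive reals. *)
Definition transitions (R : realType) n (G H : sgraph n) : set R :=
  [set eps : R | 0 < eps /\
     ~ (\forall x \near eps,
          signature (Mmx G H x) = signature (Mmx G H eps))].
Arguments transitions R [n] G H.

(* [kermx] is the left kernel, hence the transpose. *)
Definition dim_ker (R : realType) n (A : 'M[R]_n) : nat := \rank (kermx A^T).

(* Main.v *)
Require Import Defs.
From mathcomp Require Import all_boot all_order all_algebra.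
From mathcomp Require Import polyrcf complex.
From mathcomp Require Import all_classical all_reals topology normedtype.

Set Implicit Arguments.
Unset Strict Implicit.
Unset Printing Implicit Defensive.

Import Order.TTheory GRing.Theory Num.Theory.
Import numFieldNormedType.Exports.

Local Open Scope ring_scope.
Local Open Scope sesquilinear_scope.
Local Open Scope complex_scope.

(** Write [M x = L + x A] and let [r] be the maximal rank of [M x], attained at
    [x0]. If [P (M x0) Q] is the identity of size [r], then [q = \det (P M Q)]
    is a nonzero polynomial of degree at most [\rank A], and [M x] has rank [r]
    wherever [q] does not vanish. The numbers of positive and of negative
    eigenvalues are lower semicontinuous and add up to the rank, so at a point
    of maximal rank both are locally constant: every transition of the signature
    is a root of [q]. *)

(** * Ranks and determinants over polynomial matrices *)

Lemma mxrank_diag (F : fieldType) n (d : 'rV[F]_n) :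
  \rank (diag_mx d) = (\sum_i (d 0 i != 0)%R)%N.
Proof.
elim: n d => [|n IHn] d; first by rewrite big_ord0 flatmx0 mxrank0.
rewrite -(@hsubmxK _ 1 1 n d) (@diag_mx_row _ n 1).
rewrite (@rank_diag_block_mx _ 1 1 n n) IHn big_ord_recl; congr (_ + _)%N.
  rewrite rank_rV; congr (~~ _).
  apply/eqP/eqP => [/matrixP /(_ 0 0)|d0].
    rewrite !mxE eqxx mulr1n => <-.
    by case: splitP => // j _; rewrite !mxE !ord1.
  apply/matrixP => i j; rewrite !ord1 !mxE eqxx mulr1n -[RHS]d0.
  by rewrite mxE; case: splitP => // k _; rewrite !mxE !ord1.
apply: eq_bigr => i _; rewrite !mxE; case: splitP => [j|j]; first by rewrite !ord1.
move=> ij; rewrite !mxE; congr (nat_of_bool (d _ _ != 0)).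
by apply: val_inj; rewrite /= -ij.
Qed.

(** Each term of the Leibniz expansion takes one entry from every row, so the degree bounds of the
    rows add up. *)
Lemma size_det_leq (R : idomainType) n (B : 'M[{poly R}]_n) (d : 'I_n -> nat) :
  (forall i j, size (B i j) <= (d i).+1)%N ->
  (size (\det B) <= (\sum_i d i).+1)%N.
Proof.
move=> dB; apply: leq_trans (size_sum _ _ _) _.
apply/bigmax_leqP => s _; rewrite -polyC1 -polyCN -polyC_exp mul_polyC.
apply: leq_trans (size_scale_leq _ _) _.
apply: leq_trans (size_prod_leq _ _) _.
rewrite leq_subLR cardE enumT -/(index_enum _) -sum1_size addnS ltnS -big_split.
exact: leq_sum.
Qed.

Lemma size_det_pencil (F : fieldType) n (L A : 'M[F]_n) :
  (size (\det (map_mx polyC L + 'X *: map_mx polyC A)) <= (\rank A).+1)%N.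
Proof.
(* Up to invertible factors, 'X occurs only in the first [\rank A] rows. *)
set C := col_ebase A; set D := row_ebase A.
set K := invmx C *m L *m invmx D.
have -> : map_mx polyC L + 'X *: map_mx polyC A =
    map_mx polyC C *m (map_mx polyC K + 'X *: map_mx polyC (pid_mx (\rank A)))
      *m map_mx polyC D.
  rewrite mulmxDr mulmxDl -!map_mxM -scalemxAr -scalemxAl -!map_mxM /K.
  by rewrite !mulmxA mulmxV ?col_ebase_unit // mul1mx mulmxKV ?row_ebase_unit //
             mulmx_ebase.
rewrite !det_mulmx !det_map_mx mulrC mul_polyC mul_polyC.
do 2 apply: leq_trans (size_scale_leq _ _) _.
(* The rank as a sum of indicators: row [i] of the reduced pencil has degree at most 1 if
   [i < \rank A], and is constant otherwise. *)
have rE : \rank A = (\sum_(i < n) (i < \rank A)%N)%N.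
  rewrite -[LHS]card_ord -sum1_card (big_ord_widen n (fun=> 1%N)) ?rank_leq_row //.
  by rewrite big_mkcond; apply: eq_bigr => i _; case: (i < _)%N.
rewrite {2}rE; apply: size_det_leq => i j; rewrite !mxE.
apply: leq_trans (size_polyD _ _) _; rewrite geq_max size_polyC.
apply/andP; split; first by case: (_ != 0).
case: (i < _)%N; last by rewrite andbF mulr0 size_poly0.
apply: leq_trans (size_polyMleq _ _) _.
by rewrite size_polyX size_polyC; case: (_ != 0).
Qed.

(** * Inertia of real symmetric matrices via the spectral theorem *)

Section Inertia.
Variable R : realType.

(** Turns the root multiplicities in [Npos] and [Nneg] into a count along a list of eigenvalues with
    repetitions. *)
Lemma sum_mup_prod_XsubC (P : pred R) (s : seq R) (p := \prod_(x <- s) ('X - x%:P)) :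
  (\sum_(x <- rootsR p | P x) mup x p)%N = count P s.
Proof.
rewrite (eq_bigr (fun x => count_mem x s)) => [|x _]; last exact: mu_prod_XsubC.
have p0 : p != 0 by rewrite monic_neq0 ?monic_prod_XsubC.
have rp x : (x \in rootsR p) = (x \in s).
  by rewrite -(roots_on_rootsR p0) root_prod_XsubC.
have up : uniq (rootsR p) by apply: uniq_roots.
transitivity (\sum_(x <- rootsR p | P x) count_mem x [seq y <- s | P y])%N.
  apply: eq_bigr => x Px; rewrite count_filter; apply: eq_count => y /=.
  by case: eqP => // ->; rewrite Px.
rewrite -size_filter -big_filter.
set t := [seq x <- rootsR p | _].
(* Double counting: after exchanging the sums, each [y] meets exactly one [x], because [t] has no
   duplicates. *)
rewrite (eq_bigr (fun x => \sum_(y <- [seq y <- s | P y]) (y == x))%N); last first.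
  by move=> x _; rewrite -sum1_count big_mkcond; apply: eq_bigr => y _ /=; case: eqP.
rewrite exchange_big /= -sum1_size !big_seq; apply: eq_bigr => y.
rewrite mem_filter => /andP[Py ys].
rewrite (bigD1_seq y) ?filter_uniq ?mem_filter ?Py ?rp //= eqxx big1 //.
by move=> x /negPf xy; rewrite eq_sym xy.
Qed.

Local Notation rc := (real_complex R).

Lemma real_complex_real (x : R) : rc x \is Num.real.
Proof. by rewrite complex_real. Qed.

(** Over [R[i]] the matrix becomes hermitian, so the spectral theorem applies. Its eigenvalues are
    real and descend to [e] over [R]; [U] stays complex. *)
Lemma symmetric_spectral n (A : 'M[R]_n) : A^T = A ->
  exists (U : 'M[R[i]]_n) (e : 'rV[R]_n), U \is unitarymx /\
    map_mx rc A = U^t* *m diag_mx (map_mx rc e) *m U.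
Proof.
move=> symA; set Ac := map_mx rc A.
have hA : Ac \is hermsymmx.
  apply/is_hermitianmxP; rewrite expr0 scale1r; apply/matrixP => i j.
  rewrite !mxE -[in LHS]symA mxE; apply/esym/CrealP; exact: real_complex_real.
have /mxOverP ereal := hermitian_spectral_diag_real hA.
exists (spectralmx Ac), (map_mx (@complex.Re R) (spectral_diag Ac)); split.
  exact: spectral_unitarymx.
have -> : map_mx rc (map_mx (@complex.Re R) (spectral_diag Ac)) =
    spectral_diag Ac.
  by apply/matrixP => i j; rewrite !mxE; apply: RRe_real.
rewrite -invmx_unitary ?spectral_unitarymx //.
exact/orthomx_spectralP/hermitian_normalmx.
Qed.

Lemma char_poly_unitary_diag n (A : 'M[R]_n) (U : 'M[R[i]]_n) (e : 'rV[R]_n) :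
  U \is unitarymx -> map_mx rc A = U^t* *m diag_mx (map_mx rc e) *m U ->
  char_poly A = \prod_(i < n) ('X - (e 0 i)%:P).
Proof.
move=> uU eA; apply: (map_poly_inj rc).
rewrite map_char_poly eA rmorph_prod /=.
under eq_bigr do rewrite rmorphB /= map_polyX map_polyC.
rewrite /char_poly /char_poly_mx.
have -> : 'X%:M - map_mx polyC (U^t* *m diag_mx (map_mx rc e) *m U) =
  map_mx polyC (U^t*) *m char_poly_mx (diag_mx (map_mx rc e)) *m map_mx polyC U.
  rewrite mulmxBr mulmxBl -!map_mxM; congr (_ - _).
  rewrite scalar_mxC -mulmxA -map_mxM.
  by rewrite -invmx_unitary // mulVmx ?unitarymx_unit // map_mx1 mulmx1.
rewrite !det_mulmx mulrAC -det_mulmx -map_mxM.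
rewrite -invmx_unitary // mulVmx ?unitarymx_unit // map_mx1 det1 mul1r.
rewrite -/(char_poly _) char_poly_trig ?diag_mx_is_trig //.
by apply: eq_bigr => i _; rewrite !mxE eqxx mulr1n.
Qed.

Definition qform n (A : 'M[R[i]]_n) (v : 'rV_n) : R[i] := (v *m A *m v^t*) 0 0.

Lemma qform_unitary_diag n (U : 'M[R[i]]_n) (d v : 'rV_n) :
  qform (U^t* *m diag_mx d *m U) v = \sum_i d 0 i * `|(v *m U^t*) 0 i| ^+ 2.
Proof.
rewrite /qform !mulmxA -[_ *m U *m _]mulmxA mxE; apply: eq_bigr => i _.
rewrite mul_mx_diag !mxE normCK mulrAC mulrC; congr (_ * (_ * _)).
rewrite rmorph_sum; apply: eq_bigr => j _.
by rewrite !mxE rmorphM /= conjCK mulrC.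
Qed.

Section Spectral.
Variables (n : nat) (A : 'M[R]_n) (U : 'M[R[i]]_n) (e : 'rV[R]_n).
Hypothesis uU : U \is unitarymx.
Hypothesis eA : map_mx rc A = U^t* *m diag_mx (map_mx rc e) *m U.

Lemma Npos_spectral : Npos A = (\sum_i (0 < e 0 i)%R)%N.
Proof.
rewrite /Npos (char_poly_unitary_diag uU eA).
rewrite -(big_map (e 0) xpredT (fun x => 'X - x%:P)) sum_mup_prod_XsubC.
rewrite -sum1_count big_map big_mkcond.
by apply: eq_bigr => i _; case: (0 < _).
Qed.

Lemma Nneg_spectral : Nneg A = (\sum_i (e 0 i < 0)%R)%N.
Proof.
rewrite /Nneg (char_poly_unitary_diag uU eA).
rewrite -(big_map (e 0) xpredT (fun x => 'X - x%:P)) sum_mup_prod_XsubC.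
rewrite -sum1_count big_map big_mkcond.
by apply: eq_bigr => i _; case: (_ < 0).
Qed.

Lemma rank_spectral : \rank A = (Npos A + Nneg A)%N.
Proof.
rewrite Npos_spectral Nneg_spectral -(mxrank_map rc) eA.
rewrite mxrankMfree ?row_free_unit ?unitarymx_unit //.
rewrite -mxrank_tr trmx_mul mxrankMfree; last first.
  by rewrite row_free_unit unitmx_tr -invmx_unitary // unitmx_inv unitarymx_unit.
rewrite tr_diag_mx mxrank_diag -big_split; apply: eq_bigr => i _ /=.
by rewrite mxE fmorph_eq0; case: ltgtP.
Qed.

(** The rows of [U] are eigenvectors; those whose eigenvalue fails [P] are replaced by zero, which
    keeps the matrix square. *)
Definition spectral_space (P : pred R) : 'M[R[i]]_n :=
  diag_mx (\row_i (P (e 0 i))%:R) *m U.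

Lemma rank_spectral_space P : \rank (spectral_space P) = (\sum_i (P (e 0 i))%R)%N.
Proof.
rewrite mxrankMfree ?row_free_unit ?unitarymx_unit // mxrank_diag.
by apply: eq_bigr => i _; rewrite mxE pnatr_eq0 eqb0 negbK.
Qed.

Lemma spectral_spaceP P (v : 'rV_n) i : (v <= spectral_space P)%MS -> ~~ P (e 0 i) ->
  (v *m U^t*) 0 i = 0.
Proof.
move=> /submxP[w ->] /negPf Pi.
by rewrite mulmxA mulmxtVK // mul_mx_diag !mxE Pi mulr0.
Qed.

(** A space on which the form is positive definite meets the span [Z] of the eigenvectors with
    eigenvalue at most 0 trivially, and [Z] has dimension [n - Npos A]. *)
Lemma rank_pos_leq m (W : 'M[R[i]]_(m, n)) :
  (forall v : 'rV_n, (v <= W)%MS -> v != 0 -> 0 < qform (map_mx rc A) v) ->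
  (\rank W <= Npos A)%N.
Proof.
move=> Wpos; pose Z := spectral_space (fun x => x <= 0).
have WZ : (W :&: Z)%MS = 0.
  apply/eqP/rowV0P => v; rewrite sub_capmx => /andP[vW vZ].
  apply/eqP/negPn/negP => v0; have := Wpos v vW v0; rewrite eA qform_unitary_diag.
  (* The order on [R[i]] is partial, so negating [<] requires the sum to be real. *)
  apply/negP; rewrite -real_leNgt ?real0 //; last first.
    by apply: rpred_sum => i _; rewrite rpredM ?rpredX ?normr_real // mxE real_complex_real.
  apply: sumr_le0 => i _; rewrite mxE.
  have [ei|ei] := lerP (e 0 i) 0; last first.
    by rewrite (spectral_spaceP vZ) ?normr0 ?expr0n ?mulr0 // -ltNge.
  by rewrite mulr_le0_ge0 ?exprn_ge0 //; move: ei; rewrite -lecR.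
rewrite -(leq_add2r (\rank Z)) -(mxrank_disjoint_sum WZ).
apply: leq_trans (rank_leq_col _) _.
rewrite rank_spectral_space Npos_spectral -big_split /=.
rewrite -[X in (X <= _)%N]card_ord -sum1_card.
by apply: leq_sum => i _; case: ltP.
Qed.

End Spectral.

(** * Behaviour of the inertia along a pencil *)

Lemma unitary_diagN n (A U : 'M[R[i]]_n) (d : 'rV[R]_n) :
  A = U^t* *m diag_mx (map_mx rc d) *m U ->
  - A = U^t* *m diag_mx (map_mx rc (- d)) *m U.
Proof. by move=> ->; rewrite !map_mxN raddfN /= mulmxN mulNmx. Qed.

Lemma NposN n (A : 'M[R]_n) : A^T = A -> Npos (- A) = Nneg A.
Proof.
move=> /symmetric_spectral[U [e [uU eA]]].
have eN : map_mx rc (- A) = U^t* *m diag_mx (map_mx rc (- e)) *m U.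
  by rewrite map_mxN; apply: unitary_diagN.
rewrite (Nneg_spectral uU eA) (Npos_spectral uU eN).
by apply: eq_bigr => i _; rewrite mxE oppr_gt0.
Qed.

Lemma qform_real n (A : 'M[R]_n) v :
  A^T = A -> qform (map_mx rc A) v \is Num.real.
Proof.
move=> /symmetric_spectral[U [e [_ ->]]]; rewrite qform_unitary_diag.
apply: rpred_sum => i _.
by rewrite rpredM ?rpredX ?normr_real // mxE real_complex_real.
Qed.

Lemma norm_qform_le n (A : 'M[R[i]]_n) (v : 'rV_n) :
  `|qform A v| <= (\sum_j \sum_i `|A i j|) * \sum_k `|v 0 k| ^+ 2.
Proof.
rewrite /qform mxE mulr_suml; apply: le_trans (ler_norm_sum _ _ _) _.
apply: ler_sum => j _; rewrite !mxE normrM norm_conjC mulr_suml.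
apply: le_trans (ler_wpM2r (normr_ge0 _) (ler_norm_sum _ _ _)) _.
rewrite mulr_suml; apply: ler_sum => i _.
rewrite normrM [`|v 0 i| * _]mulrC -mulrA ler_wpM2l //.
have vk k : `|v 0 k| ^+ 2 <= \sum_k `|v 0 k| ^+ 2.
  by rewrite (bigD1 k) //= lerDl sumr_ge0 // => l _; rewrite exprn_ge0.
have S0 : 0 <= \sum_k `|v 0 k| ^+ 2.
  by apply: sumr_ge0 => k _; rewrite exprn_ge0.
(* The product of two coordinates is compared with the sum of squares after squaring: each squared
   factor is at most that sum. *)
rewrite -(@ler_pXn2r _ 2) ?nnegrE ?mulr_ge0 // exprMn [leRHS]expr2.
by rewrite ler_pM ?exprn_ge0.
Qed.

(* The form of [A + x0 B] is positive definite on the span of its eigenvectors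
   with positive eigenvalues, and remains so after a small perturbation. *)
Lemma Npos_lower_semicontinuous n (A B : 'M[R]_n) (x0 : R) :
  A^T = A -> B^T = B ->
  \forall x \near x0, (Npos (A + x0 *: B) <= Npos (A + x *: B))%N.
Proof.
move=> symA symB.
have symM x : (A + x *: B)^T = A + x *: B by rewrite linearD linearZ /= symA symB.
have [U [e [uU eA]]] := symmetric_spectral (symM x0).
(* [B'] expresses [B] in the eigenbasis of [A + x0 *: B], and [K] bounds its form relative to the
   squared norm. *)
pose B' := U *m map_mx rc B *m U^t*.
have /complex_realP[K KE] : \sum_j \sum_i `|B' i j| \is Num.real.
  do 2 (apply: rpred_sum => ? _); exact: normr_real.
have K0 : 0 <= K.
  by rewrite -lecR -KE; do 2 (apply: sumr_ge0 => ? _); apply: normr_ge0.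
have near_e : \forall x \near x0, forall i, 0 < e 0 i -> `|x0 - x| * K < e 0 i.
  apply: (@filter_forall _ _ (fun i x => 0 < e 0 i -> `|x0 - x| * K < e 0 i) (nbhs x0) _) => i.
  have [ei|_] := ltrP 0 (e 0 i); last exact: nearW.
  (* The denominator is [K + 1] because [K] may vanish. *)
  have d0 : 0 < e 0 i / (K + 1) by rewrite divr_gt0 // ltr_pwDr.
  near=> x => _.
  have xd : `|x0 - x| < e 0 i / (K + 1).
    by near: x; exact: (nbhsx_ballx x0 _ d0).
  rewrite ltr_pdivlMr ?ltr_pwDr // in xd; apply: le_lt_trans xd.
  by rewrite ler_wpM2l // lerDl.
near=> x.
have xe : forall i, 0 < e 0 i -> `|x0 - x| * K < e 0 i by near: x.
rewrite [leqLHS](Npos_spectral uU eA).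
rewrite -(rank_spectral_space e uU (fun y => 0 < y)).
have [U2 [e2 [uU2 eA2]]] := symmetric_spectral (symM x).
apply: (rank_pos_leq uU2 eA2) => v vW v0.
set w := v *m U^t*.
have vE : v = w *m U by rewrite mulmxKtV.
have -> : map_mx rc (A + x *: B) =
    map_mx rc (A + x0 *: B) + (x - x0)%:C *: map_mx rc B.
  rewrite -map_mxZ -map_mxD; congr map_mx.
  by rewrite -addrA -scalerDl [x0 + _]addrC subrK.
have -> : qform (map_mx rc (A + x0 *: B) + (x - x0)%:C *: map_mx rc B) v =
    qform (map_mx rc (A + x0 *: B)) v + (x - x0)%:C * qform (map_mx rc B) v.
  by rewrite /qform mulmxDr mulmxDl mxE -scalemxAr -scalemxAl [X in _ + X = _]mxE.
rewrite eA qform_unitary_diag -/w.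
set S := \sum_i _ ; set y := _ * _.
have yle : `|y| <= \sum_i (`|x0 - x| * K)%:C * `|w 0 i| ^+ 2.
  rewrite -mulr_sumr rmorphM -mulrA normrM ler_pM //.
    by rewrite normc_def /= expr0n addr0 sqrtr_sqr distrC.
  have -> : qform (map_mx rc B) v = qform B' w.
    by rewrite /qform /B' /w !mulmxA vE trmx_mul map_mxM !mulmxA mulmxtVK.
  by apply: le_trans (norm_qform_le _ _) _; rewrite KE.
have yreal : y \is Num.real by rewrite rpredM ?real_complex_real ?qform_real.
apply: lt_le_trans (_ : S - `|y| <= _); last first.
  by rewrite lerD2l real_lerNnormlW.
rewrite subr_gt0; apply: le_lt_trans yle _.
have [i wi] : exists i, w 0 i != 0.
  by apply/rV0Pn; apply: contraNneq v0 => w0; rewrite vE w0 mul0mx.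
(* Coordinates with nonpositive eigenvalue vanish on [W], so both sides are then 0. The nonzero
   coordinate [i] makes the summed inequality strict. *)
have ge j : (`|x0 - x| * K)%:C * `|w 0 j| ^+ 2 <=
            map_mx rc e 0 j * `|w 0 j| ^+ 2.
  have [ej|ej] := ltrP 0 (e 0 j).
    by rewrite ler_wpM2r ?exprn_ge0 // mxE lecR ltW // xe.
  by rewrite (spectral_spaceP uU vW) ?normr0 ?expr0n ?mulr0 // -leNgt.
rewrite /S (bigD1 i) //= [ltRHS](bigD1 i) //= ltr_leD ?ler_sum //.
have [ei|ei] := ltrP 0 (e 0 i).
  by rewrite ltr_pM2r ?exprn_gt0 ?normr_gt0 // mxE ltcR xe.
by rewrite (spectral_spaceP uU vW) ?eqxx // -leNgt in wi.
Unshelve. all: by end_near. Qed.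

(** Near [x0] neither count can drop, while their sum, the rank, cannot exceed its value at [x0];
    hence both are unchanged. *)
Lemma signature_locally_constant n (A B : 'M[R]_n) (x0 : R) :
  A^T = A -> B^T = B ->
  (forall x, \rank (A + x *: B)%R <= \rank (A + x0 *: B)%R)%N ->
  \forall x \near x0, signature (A + x *: B) = signature (A + x0 *: B).
Proof.
move=> symA symB rmax.
have symM x : (A + x *: B)^T = A + x *: B by rewrite linearD linearZ /= symA symB.
have symN (Q : 'M[R]_n) : Q^T = Q -> (- Q)^T = - Q by move=> {2}<-; rewrite linearN.
have rankE x : \rank (A + x *: B)%R = (Npos (A + x *: B) + Nneg (A + x *: B))%N.
  by have [U [e [uU eM]]] := symmetric_spectral (symM x); exact: (rank_spectral uU eM).
near=> x.
have lepos : (Npos (A + x0 *: B) <= Npos (A + x *: B))%N.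
  by near: x; exact: Npos_lower_semicontinuous.
have leneg : (Nneg (A + x0 *: B) <= Nneg (A + x *: B))%N.
  (* Semicontinuity of [Nneg] is that of [Npos] for the pencil of [- A] and [- B]. *)
  rewrite -!NposN // !opprD -!scalerN.
  by near: x; apply: Npos_lower_semicontinuous; apply: symN.
have := rmax x; rewrite !rankE => le_sum.
have Epos : Npos (A + x *: B) = Npos (A + x0 *: B).
  apply/eqP; rewrite eqn_leq lepos andbT -(leq_add2r (Nneg (A + x0 *: B))).
  by apply: leq_trans le_sum; rewrite leq_add2l.
have Eneg : Nneg (A + x *: B) = Nneg (A + x0 *: B).
  by apply/eqP; rewrite eqn_leq leneg andbT -(leq_add2l (Npos (A + x0 *: B))) -{1}Epos.
by rewrite /signature Epos Eneg.
Unshelve. all: by end_near. Qed.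

End Inertia.

(** * Exceptional parameters of a pencil and the count of transitions *)

Lemma max_rank_pencil (F : fieldType) n (A B : 'M[F]_n) (x0 : F) :
  exists q : {poly F}, [/\ q != 0, (size q <= (\rank B).+1)%N &
    forall x, q.[x] != 0 -> (\rank (A + x0 *: B)%R <= \rank (A + x *: B)%R)%N].
Proof.
(* [P] is a left inverse of [col_base M] and [Q] a right inverse of [row_base M], so [P *m M *m Q]
   is the identity of size [\rank M]. *)
set M := A + x0 *: B; set P := pinvmx (col_base M); set Q := pinvmx (row_base M).
pose q := \det (map_mx polyC (P *m A *m Q) + 'X *: map_mx polyC (P *m B *m Q)).
have qE x : q.[x] = \det (P *m (A + x *: B) *m Q).
  rewrite -horner_evalE -det_map_mx map_mxD map_mxZ /= horner_evalE hornerX.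
  rewrite -!map_mx_comp !(map_mx_id (f := horner_eval x \o polyC)); last 2 first.
  - by move=> a; rewrite /= horner_evalE hornerC.
  - by move=> a; rewrite /= horner_evalE hornerC.
  by rewrite mulmxDr mulmxDl -scalemxAr -scalemxAl.
exists q; split.
- apply/eqP => /(congr1 (fun p => p.[x0])); rewrite qE -/M horner0.
  have -> : P *m M *m Q = 1%:M.
    rewrite -[X in _ *m X *m _](mulmx_base M) mulmxA mulVpmx ?col_base_full //.
    by rewrite mul1mx mulmxVp ?row_base_free.
  by rewrite det1 => /eqP; rewrite oner_eq0.
- apply: leq_trans (size_det_pencil _ _) _; rewrite ltnS.
  by apply: leq_trans (mxrankM_maxl _ _) (mxrankM_maxr _ _).
(* A nonzero determinant gives the compressed matrix full rank [\rank M], and compression cannot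
   raise the rank. *)
- move=> x; rewrite qE -unitfE -unitmxE => /mxrank_unit <-.
  by apply: leq_trans (mxrankM_maxl _ _) (mxrankM_maxr _ _).
Qed.

Lemma card_seq_le (T : pointedType) (s : seq T) (m : nat) :
  (size s <= m)%N -> ([set` s] #<= `I_m)%card.
Proof.
move=> sm; have sub : ([set` s] `<=` nth point s @` `I_(size s))%classic.
  by move=> x /= /(nthP point)[i si <-]; exists i.
apply: card_le_trans (subset_card_le sub) _.
by apply: card_le_trans (card_image_le _ _) _; rewrite card_le_II.
Qed.

Theorem proposition4 (R : realType) (n : nat) (F G H : sgraph n)
  (subGF : edges G \subset edges F) (subHF : edges H \subset edges F)
  (disjGH : (edges G :&: edges H)%SET = finset.set0)
  (unionGH : (edges G :|: edges H)%SET = edges F) :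
  (transitions R G H #<= `I_(n - dim_ker (adjacency_mx R H)))%card.
Proof.
have symadj (K : sgraph n) : (adjacency_mx R K)^T = adjacency_mx R K.
  by apply/matrixP => i j; rewrite !mxE /adjacent finset.setUC.
set A := laplacian_mx R G; set B := adjacency_mx R H.
have symA : A^T = A by rewrite linearB /= tr_diag_mx symadj.
(* The maximum runs over all real [x]; [x0] need not be positive, as it serves only to produce
   [q]. *)
have [r [x0 rx0] rmax] : exists2 r, exists x, \rank (A + x *: B)%R = r &
    forall x, (\rank (A + x *: B)%R <= r)%N.
  have P0 : exists r, `[< exists x, \rank (A + x *: B)%R = r >].
    by exists (\rank (A + 0 *: B)%R); apply/asboolP; exists 0.
  have Pub r : `[< exists x, \rank (A + x *: B)%R = r >] -> (r <= n)%N.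
    by move=> /asboolP[x <-]; exact: rank_leq_row.
  case: (ex_maxnP P0 Pub) => r /asboolP xr rmax; exists r => // x.
  by apply: rmax; apply/asboolP; exists x.
have [q [q0 sq rq]] := max_rank_pencil A B x0.
have sub : (transitions R G H `<=` [set` rootsR q])%classic.
  move=> x [_ xtrans] /=; rewrite -(roots_on_rootsR q0) /=.
  apply/negPn/negP => qx; apply: xtrans; apply: signature_locally_constant => // y.
  by apply: leq_trans (rmax y) _; rewrite -rx0 rq.
apply: card_le_trans (subset_card_le sub) _; apply: card_seq_le.
(* The bound becomes [\rank B]. A nonzero polynomial has fewer distinct roots than its size, which
   absorbs the successor in [sq]. *)
rewrite /dim_ker mxrank_ker mxrank_tr subKn ?rank_leq_row //.
rewrite -ltnS; apply: leq_trans sq; apply: max_poly_roots => //.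
  by apply/allP => x; rewrite -(roots_on_rootsR q0).
exact: uniq_roots.
Qed.
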